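(* Let $\tilde M = WH+N\in\mathbb{R}^{r\times n}$ be a near-separable matrix with $m=r$ and noise level $\epsilon\ge 0$ (as defined in the context), and suppose $$\epsilon \le \frac{\sigma_{\min}(W)}{8 r\sqrt r}.$$ Let $C^*$ be the optimal solution of $$\min_{C\in\mathbb{S}^r_+}\ \log\det(C)^{-1}+\log\det(WW^T)\quad\text{such that}\quad \tilde m_i^T\left(W^{-T}CW^{-1}\right)\tilde m_i\le 1\ \text{ for } i=1,\dots,n.$$ Then $\kappa(C^* )\le 40$.
   Context: Near-separable matrix with $m=r$: $\tilde M = M + N \in \mathbb{R}^{r\times n}$ where $M = WH$, $W\in\mathbb{R}^{r\times r}$ has full column rank (so it is invertible), $H = [I_r \ H'] \in \mathbb{R}^{r\times n}$ is entrywise nonnegative ($I_r$ is the identity matrix), the entries of each column of $H'$ sum to at most one, and the noise satisfies $\|N(:,j)\|_2\le\epsilon$ for all $j$. The $i$th column of $\tilde M$ is denoted $\tilde m_i$. $\mathbb{S}^r_+$ is the set of $r\times r$ symmetric positive semidefinite matrices; $\log\det(C)^{-1}=+\infty$ if $C$ is singular. The optimal solution of the optimization problem exists and is unique whenever $\tilde M$ has rank $r$. $\sigma_{\max}$, $\sigma_{\min}$ denote the largest and smallest singular values, and $\kappa(B)=\sigma_{\max}(B)/\sigma_{\min}(B)$ is the condition number of $B$. *)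

(* Defs.v *)
From HB Require Import structures.
From mathcomp Require Export all_boot all_order all_algebra.
From mathcomp Require Export all_classical all_reals all_analysis.

Set Implicit Arguments.
Unset Strict Implicit.
Unset Printing Implicit Defensive.

Import Order.TTheory GRing.Theory Num.Theory.

Local Open Scope classical_set_scope.
Local Open Scope ring_scope.

(* The canonical norm of a matrix in MathComp-Analysis is the max norm, hence
   an explicit Euclidean norm here. *)
Definition norm2 (R : realType) (m : nat) (v : 'cV[R]_m) : R :=
  Num.sqrt (\sum_i v i 0 ^+ 2).

Definition singular_values (R : realType) (r : nat) (A : 'M[R]_r) : set R :=
  [set s | 0 <= s /\ eigenvalue (A^T *m A) (s ^+ 2)].

(* For 0 < r the set of singular values is finite and nonempty, so sup and inf
   are its largest and smallest elements. *)
Definition sigma_max (R : realType) (r : nat) (A : 'M[R]_r) : R :=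
  sup (singular_values A).

Definition sigma_min (R : realType) (r : nat) (A : 'M[R]_r) : R :=
  inf (singular_values A).

(* Extended-real valued, so that a singular matrix is infinitely
   ill-conditioned instead of getting the value 0 from x / 0 = 0. *)
Definition kappa (R : realType) (r : nat) (B : 'M[R]_r) : \bar R :=
  if sigma_min B == 0 then +oo%E else (sigma_max B / sigma_min B)%:E.

Definition psd (R : realType) (r : nat) (C : 'M[R]_r) : Prop :=
  C^T = C /\ forall x : 'cV[R]_r, 0 <= (x^T *m C *m x) 0 0.

(* (\det C)%:E^-1 is +oo when C is singular, and lne +oo = +oo. *)
Definition objective (R : realType) (r : nat) (W C : 'M[R]_r) : \bar R :=
  (lne ((\det C)%:E^-1) + (ln (\det (W *m W^T)))%:E)%E.

Definition feasible (R : realType) (r n : nat) (W : 'M[R]_r)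
    (Mt : 'M[R]_(r, n)) (C : 'M[R]_r) : Prop :=
  psd C /\
  forall i : 'I_n,
    ((col i Mt)^T *m ((invmx W)^T *m C *m invmx W) *m col i Mt) 0 0 <= 1.

Definition optimal_solution (R : realType) (r n : nat) (W : 'M[R]_r)
    (Mt : 'M[R]_(r, n)) (C : 'M[R]_r) : Prop :=
  feasible W Mt C /\
  forall D : 'M[R]_r, feasible W Mt D -> (objective W C <= objective W D)%E.

(* Main.v *)
(* Put P = W^-1 Mt = H + W^-1 N, so that the constraints read p_i^T C p_i <= 1
   and the columns of W^-1 N have norm at most 1 / (8 r sqrt r); let
   x = 1 / (8 r). The matrix (1 - x)^2 I is feasible, so optimality gives
   det C >= (1 - x)^(2 r) >= 3/4. The first r constraints, where p_i is close to
   e_i, give tr C <= r / (1 - 4 x), so (tr C / r)^r <= 2. Finally, AM-GM applied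
   to the eigenvalues of C, with the smallest one l and the largest one L
   replaced by L/2 and L/2, gives L det C <= 4 l (tr C / r)^r. *)
Require Import Defs.
From mathcomp Require Import all_boot all_order all_algebra.
From mathcomp Require Import all_classical all_reals all_analysis.
From mathcomp Require Import complex ring lra.

Import Order.TTheory GRing.Theory Num.Theory.
Local Open Scope ring_scope.

(** * Spectral theorem for real symmetric matrices *)

(* A is diagonalized by a unitary matrix over F[i]; for real x, the form
   x^T A x is the sum of the d_i |y_i|^2, where y = P x. *)
Lemma symmetric_spectral {F : rcfType} {n : nat} (A : 'M[F]_n) : A^T = A ->
  exists d : 'I_n -> F, [/\
    forall a, \det (a%:M - A) = \prod_i (a - d i),
    \tr A = \sum_i d i &
    forall c, (forall i, c <= d i) ->
      forall x : 'cV_n, c * (x^T *m x) 0 0 <= (x^T *m A *m x) 0 0].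
Proof.
move=> symA; pose f := real_complex F; pose AC := map_mx f A.
have fconj (x : F) : (f x)^* = f x.
  by apply: CrealP; apply/complex_realP; exists x.
have ACherm : AC \is hermsymmx.
  apply: realsym_hermsym.
    apply/is_hermitianmxP; rewrite expr0 scale1r; apply/matrixP => i j.
    by rewrite !mxE -{1}symA mxE.
  by apply/mxOverP => i j; rewrite mxE; apply/complex_realP; exists (A i j).
have /hermitian_normalmx/orthomx_spectralP := ACherm.
have := hermitian_spectral_diag_real ACherm.
have := spectral_unitarymx AC.
move: (spectralmx AC) (spectral_diag AC) => P sp uP /mxOverP spR ACE.
have Pu := unitarymx_unit uP.
pose d i := complex.Re (sp 0 i).
have dE i : f (d i) = sp 0 i by apply: RRe_real.
exists d; split.
(* The identities are proved over [F[i]] and pulled back along the injective embedding of [F]. *)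
- move=> a; apply: (@complexI F).
  rewrite -[LHS]det_map_mx rmorph_prod.
  transitivity (\det (invmx P *m ((f a)%:M - diag_mx sp) *m P)).
    congr (\det _); rewrite map_mxB map_scalar_mx /= -/AC {1}ACE.
    by rewrite mulmxBr mulmxBl mul_mx_scalar -scalemxAl mulVmx // scalemx1.
  rewrite !det_mulmx mulrAC -det_mulmx mulVmx // det1 mul1r.
  rewrite -diag_const_mx -raddfB /= det_diag.
  by apply: eq_bigr => i _; rewrite !mxE -dE -rmorphB.
- apply: (@complexI F); rewrite -[LHS]trace_map_mx -/AC ACE.
  rewrite mxtrace_mulC mulmxA mulmxV // mul1mx mxtrace_diag rmorph_sum.
  by apply: eq_bigr => i _; rewrite -dE.
- move=> c cd x; rewrite -lecR.
  pose y := P *m map_mx f x.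
  (* Here [P] is unitary, so its inverse is its conjugate transpose, and [x] equals its own
     conjugate. *)
  have yE : (map_mx f x)^T *m invmx P = y^t*%sesqui.
    rewrite invmx_unitary // trmx_mul map_mxM /=.
    suff -> : ((map_mx f x)^t*)%sesqui = (map_mx f x)^T by [].
    by apply/matrixP => i j; rewrite !mxE fconj.
  have -> : ((x^T *m A *m x) 0 0)%:C%C = \sum_i sp 0 i * (y i 0 * (y i 0)^*).
    transitivity ((map_mx f (x^T *m A *m x)) 0 0); first by rewrite [RHS]mxE.
    rewrite !map_mxM /= -/AC ACE !mulmxA -map_trmx yE -mulmxA -/y.
    rewrite mxE; apply: eq_bigr => i _; rewrite mul_mx_diag !mxE.
    by rewrite mulrC mulrA mulrC.
  have -> : (c * (x^T *m x) 0 0)%:C%C = \sum_i f c * (y i 0 * (y i 0)^*).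
    rewrite -mulr_sumr rmorphM /=; congr (_ * _).
    transitivity ((map_mx f (x^T *m x)) 0 0); first by rewrite [RHS]mxE.
    rewrite map_mxM /= -map_trmx -[X in _ *m X](mulKmx Pu).
    rewrite -/y mulmxA yE mxE; apply: eq_bigr => i _.
    by rewrite !mxE mulrC.
  apply: ler_sum => i _; rewrite -dE ler_wpM2r ?lecR ?cd //.
  by rewrite mul_conjC_ge0.
Qed.

Lemma eigenvalue_det {F : fieldType} {n : nat} (A : 'M[F]_n) (a : F) :
  eigenvalue A a = (\det (a%:M - A) == 0).
Proof.
apply/eigenvalueP/det0P => [[v vA v0]|[v v0 vA]]; exists v => //.
  by rewrite mulmxBr vA mul_mx_scalar subrr.
by apply/esym/eqP; rewrite -subr_eq0 -mul_mx_scalar -mulmxBr vA.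
Qed.

(** * Quadratic forms of positive semidefinite matrices *)

Definition bform {F : realFieldType} {n : nat} (A : 'M[F]_n) (x y : 'cV[F]_n) : F :=
  (x^T *m A *m y) 0 0.

Definition sqnorm {F : realFieldType} {n : nat} (x : 'cV[F]_n) : F :=
  (x^T *m x) 0 0.

Lemma bformDl {F : realFieldType} {n : nat} (A : 'M[F]_n) (x y z : 'cV[F]_n) :
  bform A (x + y) z = bform A x z + bform A y z.
Proof. by rewrite /bform linearD /= !mulmxDl mxE. Qed.

Lemma bformDr {F : realFieldType} {n : nat} (A : 'M[F]_n) (x y z : 'cV[F]_n) :
  bform A z (x + y) = bform A z x + bform A z y.
Proof. by rewrite /bform mulmxDr mxE. Qed.

Lemma bformZl {F : realFieldType} {n : nat} (A : 'M[F]_n) (x y : 'cV[F]_n) (a : F) :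
  bform A (a *: x) y = a * bform A x y.
Proof. by rewrite /bform linearZ /= -!scalemxAl mxE. Qed.

Lemma bformZr {F : realFieldType} {n : nat} (A : 'M[F]_n) (x y : 'cV[F]_n) (a : F) :
  bform A x (a *: y) = a * bform A x y.
Proof. by rewrite /bform -scalemxAr mxE. Qed.

Lemma bform_delta {F : realFieldType} {n : nat} (A : 'M[F]_n) (i j : 'I_n) :
  bform A (delta_mx i 0) (delta_mx j 0) = A i j.
Proof. by rewrite /bform trmx_delta -rowE -colE !mxE. Qed.

Lemma sqnormE {F : realFieldType} {n : nat} (x : 'cV[F]_n) :
  sqnorm x = \sum_i x i 0 ^+ 2.
Proof. by rewrite /sqnorm mxE; apply: eq_bigr => i _; rewrite mxE expr2. Qed.

Lemma sqnorm_ge0 {F : realFieldType} {n : nat} (x : 'cV[F]_n) : 0 <= sqnorm x.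
Proof. by rewrite sqnormE; apply: sumr_ge0 => i _; exact: sqr_ge0. Qed.

Lemma sqnorm_gt0 {F : realFieldType} {n : nat} (x : 'cV[F]_n) :
  x != 0 -> 0 < sqnorm x.
Proof.
move=> x0; rewrite lt_neqAle sqnorm_ge0 andbT eq_sym; apply: contraNneq x0.
rewrite sqnormE => /psumr_eq0P h; apply/eqP/colP => i; rewrite mxE.
by apply/eqP; rewrite -sqrf_eq0 h // => j _; exact: sqr_ge0.
Qed.

Lemma bform1 {F : realFieldType} {n : nat} (x : 'cV[F]_n) :
  bform 1%:M x x = sqnorm x.
Proof. by rewrite /bform mulmx1. Qed.

(** Multiplied by [s], the right side minus the left side is the form at [s *: x - y]. *)
Lemma psd_form_young {R : realType} {n : nat} (C : 'M[R]_n) (s : R)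
    (x y : 'cV[R]_n) : psd C -> 0 < s ->
  bform C (x + y) (x + y) <= (1 + s) * bform C x x + (1 + s^-1) * bform C y y.
Proof.
move=> [_ /(_ (s *: x + (-1) *: y))]; rewrite -/(bform _ _ _) => C0 s0.
move: C0; rewrite !(bformDl, bformDr, bformZl, bformZr) => C0.
rewrite -subr_ge0 -(pmulr_rge0 _ s0); apply: le_trans C0 _.
by rewrite le_eqVlt; apply/orP; left; apply/eqP; field; rewrite gt_eqF.
Qed.

Lemma psd_scalar {R : realType} {n : nat} (a : R) : 0 <= a -> psd (a%:M : 'M[R]_n).
Proof.
move=> a0; split=> [|x]; first by rewrite tr_scalar_mx.
by rewrite mul_mx_scalar -scalemxAl mxE mulr_ge0 // sqnorm_ge0.
Qed.

(* Summing the nonnegative values of the form at [x_i e_j - x_j e_i] over all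
   [i, j] gives [2 (tr C |x|^2 - x^T C x)]. *)
Lemma psd_form_le_trace {R : realType} {n : nat} (C : 'M[R]_n) (x : 'cV[R]_n) :
  psd C -> bform C x x <= \tr C * sqnorm x.
Proof.
move=> [_ C0].
have key i j : x i 0 * C i j * x j 0 + x i 0 * C j i * x j 0 <=
    x i 0 ^+ 2 * C j j + C i i * x j 0 ^+ 2.
  have := C0 (x i 0 *: delta_mx j 0 + (- x j 0) *: delta_mx i 0).
  rewrite -/(bform _ _ _) !(bformDl, bformDr, bformZl, bformZr) !bform_delta.
  nra.
have sumE : \sum_i \sum_j x i 0 * C i j * x j 0 = bform C x x.
  rewrite /bform mxE exchange_big; apply: eq_bigr => j _.
  by rewrite mxE mulr_suml; apply: eq_bigr => i _; rewrite !mxE.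
have : \sum_i \sum_j (x i 0 * C i j * x j 0 + x i 0 * C j i * x j 0) <=
    \sum_i \sum_j (x i 0 ^+ 2 * C j j + C i i * x j 0 ^+ 2).
  by apply: ler_sum => i _; apply: ler_sum => j _; exact: key.
under eq_bigr do rewrite big_split /=.
rewrite big_split /= sumE.
have -> : \sum_i \sum_j x i 0 * C j i * x j 0 = bform C x x.
  rewrite -sumE exchange_big; apply: eq_bigr => i _; apply: eq_bigr => j _.
  by ring.
under [X in _ <= X]eq_bigr do rewrite big_split /= -!mulr_sumr.
rewrite big_split /= -!mulr_suml -sqnormE -/(\tr C).
lra.
Qed.

(** The [d i] are the roots of the characteristic polynomial, so trace and determinant count them
    with multiplicity. The form at an eigenvector shows that they are nonnegative. *)
Lemma psd_spectral {R : realType} {n : nat} (A : 'M[R]_n) : psd A ->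
  exists d : 'I_n -> R, [/\
    forall i, 0 <= d i,
    forall a, eigenvalue A a <-> exists i, a = d i,
    \tr A = \sum_i d i,
    \det A = \prod_i d i &
    forall c, (forall i, c <= d i) -> forall x, c * sqnorm x <= bform A x x].
Proof.
move=> [symA A0]; have [d [dchar dtr dform]] := symmetric_spectral A symA.
have eigE a : eigenvalue A a <-> exists i, a = d i.
  rewrite eigenvalue_det dchar prodf_seq_eq0; split.
    by case/hasP => i _ /=; rewrite subr_eq0 => /eqP; exists i.
  by case=> i ->; apply/hasP; exists i; rewrite ?mem_index_enum //= subrr.
exists d; split=> // [i|].
  have /eigenvalueP [v vA v0] : eigenvalue A (d i) by apply/eigE; exists i.
  have := A0 v^T; rewrite trmxK vA -scalemxAl mxE.
  have : 0 < sqnorm v^T by rewrite sqnorm_gt0 // trmx_eq0.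
  by rewrite /sqnorm trmxK => /pmulr_lge0 ->.
(* The characteristic polynomial at 0 gives [\det (- A)] as the product of the [- d i]; both sides
   carry the sign [(-1) ^+ n]. *)
apply: (@mulfI _ ((-1) ^+ n)); first by rewrite signr_eq0.
have := dchar 0; rewrite raddf0 sub0r -scaleN1r detZ => ->.
have := @prodrN R 'I_n predT d; rewrite card_ord => <-.
by apply: eq_bigr => i _; rewrite sub0r.
Qed.

(** * Two scalar inequalities *)

Lemma bernoulli_le {F : realFieldType} (n : nat) (x : F) :
  0 <= x <= 1 -> 1 - n%:R * x <= (1 - x) ^+ n.
Proof.
move=> /andP[x0 x1]; elim: n => [|n IHn]; first by rewrite mul0r subr0.
rewrite exprS -natr1; apply: le_trans (ler_wpM2l _ IHn); last by rewrite subr_ge0.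
have : 0 <= n%:R * x * x by rewrite !mulr_ge0.
lra.
Qed.

(* Halving the largest factor and putting the other half in the place of the
   smallest one before applying AM-GM makes the square of the largest factor
   appear. *)
Lemma extremal_ratio_AGM {F : realFieldType} {n : nat} (d : 'I_n -> F) (i j : 'I_n) :
  (forall l, 0 <= d l) ->
  d i * \prod_l d l <= 4 * d j * ((\sum_l d l) / n%:R) ^+ n.
Proof.
move=> d0.
have AGM (e : 'I_n -> F) : (forall l, 0 <= e l) ->
    \prod_l e l <= ((\sum_l e l) / n%:R) ^+ n.
  move=> e0; have [+ _] := @leif_AGM F 'I_n predT e (fun l _ => e0 l).
  by rewrite card_ord.
have n0 : 0 <= n%:R^-1 :> F by rewrite invr_ge0.
have [->|ij] := eqVneq j i.
  apply: le_trans (ler_wpM2l (d0 i) (AGM d d0)) _.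
  have : 0 <= d i * ((\sum_l d l) / n%:R) ^+ n.
    by rewrite mulr_ge0 // exprn_ge0 // mulr_ge0 // sumr_ge0.
  lra.
(* Passing from [d] to [e] lowers the sum by exactly [d j], and [4 * d j] times the new product is
   [d i] times the old one. *)
pose e l := if (l == i) || (l == j) then d i / 2 else d l.
have e0 l : 0 <= e l by rewrite /e; case: ifP => // _; rewrite divr_ge0.
have prodE (f : 'I_n -> F) :
    \prod_l f l = f i * (f j * \prod_(l | (l != i) && (l != j)) f l).
  by rewrite (bigD1 i) //= (bigD1 j).
have sumE (f : 'I_n -> F) :
    \sum_l f l = f i + (f j + \sum_(l | (l != i) && (l != j)) f l).
  by rewrite (bigD1 i) //= (bigD1 j).
have eE l : (l != i) && (l != j) -> e l = d l.
  by rewrite /e => /andP[/negbTE -> /negbTE ->].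
have ei : e i = d i / 2 by rewrite /e eqxx.
have ej : e j = d i / 2 by rewrite /e eqxx orbT.
have -> : d i * \prod_l d l = 4 * d j * \prod_l e l.
  by rewrite !prodE ei ej (eq_bigr _ eE); field.
apply: ler_wpM2l; first by rewrite mulr_ge0.
apply: le_trans (AGM e e0) _; apply: lerXn2r; rewrite ?nnegrE.
- by rewrite mulr_ge0 // sumr_ge0.
- by rewrite mulr_ge0 // sumr_ge0.
apply: ler_wpM2r => //; rewrite !sumE ei ej (eq_bigr _ eE).
have := d0 j; lra.
Qed.

(** * Singular values and the condition number *)

Lemma psd_gram {R : realType} {n : nat} (W : 'M[R]_n) : psd (W^T *m W).
Proof.
split=> [|x]; first by rewrite trmx_mul trmxK.
rewrite -mulmxA -mulmxA mulmxA -trmx_mul; exact: sqnorm_ge0.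
Qed.

Lemma sqnorm_mul {R : realType} {n : nat} (W : 'M[R]_n) (x : 'cV[R]_n) :
  sqnorm (W *m x) = bform (W^T *m W) x x.
Proof. by rewrite /sqnorm /bform trmx_mul !mulmxA. Qed.

Lemma sqr_norm2 {R : realType} {n : nat} (x : 'cV[R]_n) :
  norm2 x ^+ 2 = sqnorm x.
Proof. by rewrite sqr_sqrtr -sqnormE ?sqnorm_ge0. Qed.

Lemma sigma_min_ge0 {R : realType} {n : nat} (W : 'M[R]_n) : 0 <= sigma_min W.
Proof.
rewrite /sigma_min.
(* For [n = 0] there are no singular values, and [inf] takes its default value 0. *)
have [->|/set0P S0] := eqVneq (singular_values W) classical_sets.set0.
  by rewrite inf0.
by apply: lb_le_inf => // s [].
Qed.

Lemma sigma_min_le {R : realType} {n : nat} (W : 'M[R]_n) (s : R) :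
  singular_values W s -> sigma_min W <= s.
Proof. by apply: ge_inf; exists 0 => t []. Qed.

(** Square roots of eigenvalues of [W^T *m W] are singular values of [W], so [sigma_min W ^+ 2] lies
    below all these eigenvalues. *)
Lemma sigma_min_sqnorm {R : realType} {n : nat} (W : 'M[R]_n) (x : 'cV[R]_n) :
  sigma_min W ^+ 2 * sqnorm x <= sqnorm (W *m x).
Proof.
have [d [d0 dE _ _ dform]] := psd_spectral _ (psd_gram W).
rewrite sqnorm_mul; apply: dform => i.
rewrite -[leRHS](sqr_sqrtr (d0 i)) lerXn2r ?nnegrE ?sigma_min_ge0 ?sqrtr_ge0 //.
apply: sigma_min_le; split; first exact: sqrtr_ge0.
by rewrite sqr_sqrtr //; apply/dE; exists i.
Qed.

(** No eigenvalue of [W^T *m W] vanishes, since its determinant is [\det W ^+ 2]. There are finitely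
    many, so the root of the least one is a positive lower bound of the singular values. *)
Lemma sigma_min_gt0 {R : realType} {n : nat} (W : 'M[R]_n) :
  (0 < n)%N -> W \in unitmx -> 0 < sigma_min W.
Proof.
move=> n0 Wu; have [d [d0 dE _ ddet _]] := psd_spectral _ (psd_gram W).
have dgt0 i : 0 < d i.
  rewrite lt_neqAle d0 andbT eq_sym; apply: contraTneq Wu => di0.
  rewrite unitmxE unitfE negbK -sqrf_eq0 expr2 -{1}det_tr -det_mulmx ddet.
  by apply/eqP/eqP/prodf_eq0; exists i => //; apply/eqP.
have [i _ imin] := @Order.TotalTheory.arg_minP _ _ _ (Ordinal n0) predT d isT.
apply: (@lt_le_trans _ _ (Num.sqrt (d i))); first by rewrite sqrtr_gt0.
apply: lb_le_inf.
  exists (Num.sqrt (d i)); split; first exact: sqrtr_ge0.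
  by rewrite sqr_sqrtr //; apply/dE; exists i.
move=> s [s0 /dE [j sj]].
by rewrite -(ger0_norm s0) -sqrtr_sqr sj ler_wsqrtr ?imin.
Qed.

(** Factor [s^2 I - C^2] as [(s I - C)(s I + C)]. If the second factor is singular, [- s] is an
    eigenvalue, hence nonnegative, which forces [s = 0]. *)
Lemma singular_values_psd {R : realType} {n : nat} (C : 'M[R]_n) (s : R) :
  psd C -> singular_values C s <-> eigenvalue C s.
Proof.
move=> psdC; have [symC _] := psdC.
have [d [d0 dE _ _ _]] := psd_spectral _ psdC.
rewrite /singular_values /= symC; split.
  case=> s0; rewrite eigenvalue_det.
  have -> : (s ^+ 2)%:M - C *m C = (s%:M - C) *m (s%:M + C).
    rewrite mulmxDr !mulmxBl !mul_mx_scalar mul_scalar_mx scale_scalar_mx.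
    by rewrite -expr2 addrA subrK.
  rewrite det_mulmx mulf_eq0 => /orP[|]; first by rewrite eigenvalue_det.
  have -> : s%:M + C = - ((- s)%:M - C) by rewrite raddfN /= opprB opprK addrC.
  rewrite -scaleN1r detZ mulf_eq0 signr_eq0 /= -eigenvalue_det.
  move=> /[dup] e /dE[i si].
  have : s = 0 by apply/eqP; rewrite eq_le s0 andbT -oppr_ge0 si.
  by move=> z; move: e; rewrite z oppr0.
move=> e; have /dE[i si] := e; split; first by rewrite si.
have /eigenvalueP [v vC v0] := e; apply/eigenvalueP; exists v => //.
by rewrite mulmxA vC -scalemxAl vC scalerA expr2.
Qed.

Lemma kappa_le {R : realType} {n : nat} (C : 'M[R]_n) (d : 'I_n -> R) (K : R) :
  (0 < n)%N -> psd C -> (forall i, 0 < d i) ->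
  (forall a, eigenvalue C a <-> exists i, a = d i) ->
  (forall i j, d i <= K * d j) -> (kappa C <= K%:E)%E.
Proof.
move=> n0 psdC d0 dE dK.
have [i _ imin] := @Order.TotalTheory.arg_minP _ _ _ (Ordinal n0) predT d isT.
have [j _ jmax] := @Order.TotalTheory.arg_maxP _ _ _ (Ordinal n0) predT d isT.
have S0 : (singular_values C !=set0)%classic.
  by exists (d i); apply/(singular_values_psd _ _ psdC)/dE; exists i.
have lo : d i <= sigma_min C.
  by apply: lb_le_inf => // s /(singular_values_psd _ _ psdC)/dE[l ->]; exact: imin.
have hi : sigma_max C <= d j.
  by apply: ge_sup => // s /(singular_values_psd _ _ psdC)/dE[l ->]; exact: jmax.
have s0 : 0 < sigma_min C := lt_le_trans (d0 i) lo.
rewrite /kappa gt_eqF // lee_fin ler_pdivrMr //.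
apply: le_trans hi (le_trans (dK j i) _); apply: ler_wpM2l => //.
(* The sign of [K] comes from [d i <= K * d i] with [d i] positive. *)
by rewrite -(pmulr_lge0 _ (d0 i)); apply: le_trans (dK i i); exact: ltW.
Qed.

(** * Consequences of optimality and of the constraints *)

(** The term in [W] is finite and cancels. A singular [C] would have objective [+oo], above the
    finite value at [D]. *)
Lemma det_le_of_objective {R : realType} {n : nat} (W C D : 'M[R]_n) :
  0 <= \det C -> 0 < \det D -> (objective W C <= objective W D)%E ->
  \det D <= \det C.
Proof.
move=> C0 D0; rewrite /objective leeD2rE // !inver (gt_eqF D0).
have [c0|cn0] := eqVneq (\det C) 0.
  by rewrite lne_EFin ?invr_gt0 //= leye_eq.
have Cgt0 : 0 < \det C by rewrite lt_neqAle eq_sym cn0.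
rewrite !lne_EFin ?invr_gt0 // lee_fin ler_ln ?posrE ?invr_gt0 //.
by rewrite lef_pV2 ?posrE.
Qed.

Lemma psd_diag_ge0 {R : realType} {n : nat} (C : 'M[R]_n) (i : 'I_n) :
  psd C -> 0 <= C i i.
Proof. by case=> _ /(_ (delta_mx i 0)); rewrite -/(bform _ _ _) bform_delta. Qed.

(** Write [e_i] as [(e_i + w_i) - w_i] and apply [psd_form_young] with parameter [x]: the first part
    contributes at most [1 + x] to [C i i], the second at most [(1 + 1/x) * \tr C * |w_i|^2].
    Summing over [i] bounds the trace in terms of itself with the small factor [x + x^2]. *)
Lemma trace_le_of_perturbed_basis {R : realType} {n : nat} (C : 'M[R]_n)
    (w : 'I_n -> 'cV[R]_n) (x : R) : psd C -> 0 < x ->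
  (forall i, bform C (delta_mx i 0 + w i) (delta_mx i 0 + w i) <= 1) ->
  \sum_i sqnorm (w i) <= x ^+ 2 ->
  \tr C * (1 - x - x ^+ 2) <= (1 + x) * n%:R.
Proof.
move=> psdC x0 Cle wle.
have tr0 : 0 <= \tr C by apply: sumr_ge0 => i _; exact: psd_diag_ge0.
have x10 : 0 <= 1 + x^-1 by rewrite addr_ge0 // invr_ge0 ltW.
have Cii i : C i i <= (1 + x) + (1 + x^-1) * (\tr C * sqnorm (w i)).
  rewrite -bform_delta -[delta_mx i 0](addrK (w i)) -scaleN1r.
  apply: le_trans (psd_form_young C x _ _ psdC x0) _; apply: lerD.
    by rewrite -[leRHS]mulr1 ler_wpM2l // addr_ge0 // ltW.
  rewrite ler_wpM2l // bformZl bformZr mulrA mulrNN !mul1r.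
  exact: psd_form_le_trace.
have trle : \tr C <= (1 + x) * n%:R + (1 + x^-1) * (\tr C * \sum_i sqnorm (w i)).
  apply: (le_trans (ler_sum _ (fun i _ => Cii i))).
  by rewrite big_split /= sumr_const card_ord mulr_natr -!mulr_sumr.
have : (1 + x^-1) * (\tr C * \sum_i sqnorm (w i)) <= \tr C * (x + x ^+ 2).
  have -> : \tr C * (x + x ^+ 2) = (1 + x^-1) * (\tr C * x ^+ 2).
    by field; rewrite gt_eqF.
  by do 2!apply: ler_wpM2l => //.
lra.
Qed.

Lemma sqnorm_le1 {F : realFieldType} {n : nat} (h : 'cV[F]_n) :
  (forall i, 0 <= h i 0) -> \sum_i h i 0 <= 1 -> sqnorm h <= 1.
Proof.
move=> h0 h1; rewrite sqnormE; apply: (le_trans _ h1); apply: ler_sum => i _.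
rewrite expr2 -[leRHS]mulr1 ler_wpM2l //; apply: (le_trans _ h1).
by rewrite (bigD1 i) //= lerDl sumr_ge0.
Qed.

Theorem theorem4 (R : realType) (r k : nat) (r_gt0 : (0 < r)%N)
    (W : 'M[R]_r) (H' : 'M[R]_(r, k)) (H N Mt : 'M[R]_(r, r + k)) (eps : R)
    (W_full_rank : \rank W = r)
    (H_def : H = row_mx 1%:M H')
    (H_ge0 : forall i j, 0 <= H i j)
    (H'_col_sum : forall j, \sum_i H' i j <= 1)
    (eps_ge0 : 0 <= eps)
    (N_le : forall j, norm2 (col j N) <= eps)
    (Mt_def : Mt = W *m H + N)
    (eps_le : eps <= sigma_min W / (8 * r%:R * Num.sqrt r%:R))
    (C : 'M[R]_r) (C_opt : optimal_solution W Mt C) :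
  (kappa C <= 40%:E)%E.
Proof.
have Wu : W \in unitmx by rewrite -row_full_unit /row_full W_full_rank.
have s0 := sigma_min_gt0 W r_gt0 Wu.
have rR : 1 <= r%:R :> R by rewrite ler1n.
have rR0 : 0 < r%:R :> R by exact: lt_le_trans rR.
pose x : R := (8 * r%:R)^-1.
have x0 : 0 < x by rewrite invr_gt0 mulr_gt0.
have rx : r%:R * x = 1 / 8 by rewrite /x; field; rewrite gt_eqF.
have x8 : x <= 1 / 8 by rewrite -rx ler_peMl // ltW.
pose w j := invmx W *m col j N.
(* The noise bound divided by [sigma_min W] is [x / sqrt r]. The factor [1 / r] in the square lets
   [r] such terms sum to [x ^+ 2]. *)
have w_le j : sqnorm (w j) <= x ^+ 2 / r%:R.
  rewrite -(ler_pM2l (exprn_gt0 2 s0)).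
  apply: le_trans (sigma_min_sqnorm W (w j)) _; rewrite /w mulKVmx //.
  have -> : sigma_min W ^+ 2 * (x ^+ 2 / r%:R) =
      (sigma_min W / (8 * r%:R * Num.sqrt r%:R)) ^+ 2.
    have q0 : Num.sqrt r%:R != 0 :> R by rewrite gt_eqF // sqrtr_gt0.
    rewrite /x -{2}(sqr_sqrtr (ltW rR0)).
    by field; rewrite q0 gt_eqF.
  rewrite -sqr_norm2 lerXn2r ?nnegrE ?sqrtr_ge0 ?(le_trans (N_le j)) //.
  exact: le_trans eps_le.
have w_le' j : sqnorm (w j) <= x ^+ 2.
  by apply: le_trans (w_le j) _; rewrite ler_pdivrMr // ler_peMr // sqr_ge0.
have VMt j : invmx W *m col j Mt = col j H + w j.
  by rewrite Mt_def linearD /= mulmxDr [col j (_ *m _)]colE -mulmxA -colE mulKmx.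
have constrE (D : 'M[R]_r) j :
    ((col j Mt)^T *m ((invmx W)^T *m D *m invmx W) *m col j Mt) 0 0 =
    bform D (col j H + w j) (col j H + w j).
  by rewrite -VMt /bform trmx_mul !mulmxA.
have h_le j : sqnorm (col j H) <= 1.
  apply: sqnorm_le1 => [i|]; first by rewrite mxE.
  under eq_bigr do rewrite mxE.
  rewrite H_def; case: (split_ordP j) => l ->.
    under eq_bigr do rewrite row_mxEl mxE.
    rewrite (bigD1 l) //= eqxx big1 ?addr0 // => i /negbTE -> //.
  by under eq_bigr do rewrite row_mxEr; exact: H'_col_sum.
have [[psdC Cfeas] Copt] := C_opt.
have [d [d0 dE dtr ddet _]] := psd_spectral C psdC.
have detC : 3 / 4 <= \det C.
  (* Each constraint vector has norm at most [1 + x], and [(1 - x)^2 (1 + x)^2 <= 1], so this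
     multiple of the identity is feasible. *)
  pose a := (1 - x) ^+ 2.
  have deta : 3 / 4 <= \det (a%:M : 'M[R]_r).
    rewrite det_scalar /a -exprM.
    apply: le_trans (bernoulli_le (2 * r) x _); last by apply/andP; split; lra.
    by rewrite natrM -mulrA rx; lra.
  apply: (le_trans deta); apply: (det_le_of_objective W).
  - by rewrite ddet prodr_ge0.
  - by apply: lt_le_trans deta.
  apply: Copt; split; first by apply: psd_scalar; exact: sqr_ge0.
  move=> j; rewrite constrE.
  have -> y : bform (a%:M) y y = a * bform 1%:M y y.
    by rewrite /bform !mul_mx_scalar -!scalemxAl scale1r mxE.
  (* With parameter [x] the bound is [(1 + x) + (1 + 1/x) x^2 = (1 + x)^2], as sharp as the triangle
     inequality. *)
  have := psd_form_young 1%:M x (col j H) (w j) (psd_scalar _ ler01) x0.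
  rewrite !bform1.
  have : (1 + x^-1) * sqnorm (w j) <= (1 + x^-1) * x ^+ 2.
    by rewrite ler_wpM2l // addr_ge0 // invr_ge0 ltW.
  have -> : (1 + x^-1) * x ^+ 2 = x + x ^+ 2 by field; rewrite gt_eqF.
  have : (1 + x) * sqnorm (col j H) <= (1 + x) * 1.
    by rewrite ler_wpM2l // addr_ge0 // ltW.
  move=> h1 h2 h3.
  have : bform 1%:M (col j H + w j) (col j H + w j) <= (1 + x) ^+ 2.
    rewrite bform1; lra.
  rewrite bform1 => h4; apply: le_trans (ler_wpM2l (sqr_ge0 _) h4) _.
  by rewrite -exprMn expr_le1 //; nra.
have d_gt0 i : 0 < d i.
  rewrite lt_neqAle d0 andbT eq_sym; apply: contraTneq detC => di0.
  rewrite ddet (bigD1 i) //= di0 mul0r -ltNge; lra.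
apply: (kappa_le C d) => // i j.
have trC : \tr C / r%:R <= (1 - 4 * x)^-1.
  pose w' (i : 'I_r) := w (lshift k i).
  (* The identity block of [H] makes the first [r] constraints perturbations of the basis
     vectors. *)
  have e_col l : col (lshift k l) H = delta_mx l 0.
    by rewrite H_def colKl col1.
  have /(_ _ _) trle := trace_le_of_perturbed_basis C w' x psdC x0.
  have {}trle : \tr C * (1 - x - x ^+ 2) <= (1 + x) * r%:R.
    apply: trle => [l|]; first by rewrite -e_col -constrE.
    apply: le_trans (_ : \sum_(l < r) x ^+ 2 / r%:R <= _).
      by apply: ler_sum => l _; exact: w_le.
    by rewrite sumr_const card_ord -[leLHS]mulr_natr divfK // gt_eqF.
  rewrite -[leRHS]div1r ler_pdivlMr; last by lra.
  rewrite mulrAC ler_pdivrMr // mul1r.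
  have tr0 : 0 <= \tr C by rewrite dtr sumr_ge0.
  have y0 : 0 < 1 - x - x ^+ 2 by nra.
  rewrite -(ler_pM2r y0).
  have x4 : 0 <= 1 - 4 * x by lra.
  have h : (\tr C * (1 - x - x ^+ 2)) * (1 - 4 * x) <= (1 + x) * r%:R * (1 - 4 * x).
    exact: ler_wpM2r.
  (* This is [(1 + x) / (1 - x - x^2) <= 1 / (1 - 4 x)] with denominators cleared; the simpler bound
     suits Bernoulli's inequality. *)
  have h' : r%:R * ((1 + x) * (1 - 4 * x)) <= r%:R * (1 - x - x ^+ 2).
    by rewrite ler_pM2l //; nra.
  lra.
have trCr : (\tr C / r%:R) ^+ r <= 2.
  have b : 1 / 2 <= (1 - 4 * x) ^+ r.
    apply: le_trans (bernoulli_le r (4 * x) _); last by apply/andP; split; lra.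
    by rewrite mulrCA rx; lra.
  apply: (@le_trans _ _ ((1 - 4 * x)^-1 ^+ r)).
    by rewrite lerXn2r ?nnegrE ?invr_ge0 ?divr_ge0 // ?dtr ?sumr_ge0 //; lra.
  rewrite exprVn -[leRHS]invrK lef_pV2 ?posrE ?invr_gt0 //; lra.
(* The bounds combine to [3/4 * d i <= 8 * d j], that is [d i <= 32/3 * d j], which is within the
   factor 40. *)
have := extremal_ratio_AGM d i j d0; rewrite -ddet -dtr => key.
have h1 : d i * (3 / 4) <= d i * \det C by rewrite ler_wpM2l.
have h2 : 4 * d j * (\tr C / r%:R) ^+ r <= 4 * d j * 2.
  by rewrite ler_wpM2l // mulr_ge0.
have := d0 j; lra.
Qed.
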